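(* Let $p>2$ be a prime and let $A_p=[a_0^{(p)},\ldots,a_{p-1}^{(p)}]$ and $B_p=[b_0^{(p)},\ldots,b_{p-1}^{(p)}]$ be the sequences of length $p$ defined by $a_0^{(p)}=0$, $a_j^{(p)}=2\left(\frac{j}{p}\right)$ for $j=1,\ldots,p-1$, and $b_0^{(p)}=1+i$, $b_j^{(p)}=0$ for $j=1,\ldots,p-1$, where $\left(\frac{\cdot}{p}\right)$ is the Legendre symbol. Then the following hold. 1. $PAF(A_p,0)=4(p-1)$, $PAF(B_p,0)=2$, and $PAF(A_p,s)=-4$, $PAF(B_p,s)=0$ for $s=1,2,\ldots,p-1$. 2. For $s=1,2,\ldots,p-1$: $$DFT(A_p,s)=\left\{\begin{array}{cc} 2\left(\frac{s}{p}\right)p^{1/2}, & p\equiv 1\bmod 4,\\ 2i\left(\frac{s}{p}\right)p^{1/2}, &p\equiv 3\bmod 4,\end{array}\right.\qquad DFT(B_p,s)=1+i,$$ $$PSD(A_p,s)=4p,\quad PSD(B_p,s)=2,\quad PSD(A_p,s)+PSD(B_p,s)=2(2p+1).$$ 3. There are exactly four $2$-decompressions $A=[a_0,a_1,\ldots,a_{2p-1}]$ of $A_p$; they are defined by $$a_p=-a_0,\quad a_0\in\{-1,1,-i,i\},\qquad a_j=a_{j+p}=\left(\frac{j}{p}\right),\quad j=1,2,\ldots,p-1.$$ They satisfy $PAF(A,0)=2p$, $PAF(A,p)=2p-4$, $PAF(A,s)=PAF(A,2p-s)=-2$ for $s=1,\ldots,p-1$; $$DFT(A,2s)=2\left(\frac{s}{p}\right)\left\{\begin{array}{cc}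 p^{1/2}, & p\equiv 1\bmod 4,\\ ip^{1/2}, &p\equiv 3\bmod 4,\end{array}\right.\qquad PSD(A,2s)=4p,\quad s=1,2,\ldots,p-1;$$ $$DFT(A,2s-1)=2a_0,\quad PSD(A,2s-1)=4,\quad s=1,2,\ldots,p.$$ 4. Let $B=[b_0,b_1,\ldots,b_{2p-1}]$ be a $2$-decompression of $B_p$. Then $$b_0+b_p=1+i\quad\mbox{and}\quad b_{j+p}=-b_j,\quad j=1,2,\ldots,p-1,$$ $$PAF(B,0)=2p,\quad PAF(B,p)=-2p+2,$$ $$DFT(B,2s)=1+i,\quad PSD(B,2s)=2,\quad s=1,2,\ldots,p-1.$$ 5. If in addition $(A,B)$ is a Legendre pair, where $A$ is a $2$-decompression of $A_p$ and $B$ is a $2$-decompression of $B_p$, then $$PAF(B,s)=PAF(B,2p-s)=0,\quad s=1,2,\ldots,p-1,$$ $$PSD(B,2s-1)=4p-2,\quad s=1,2,\ldots,p,$$ and $DFT(B,p)=a+ib$ with integers $a,b$ satisfying $a^2+b^2=4p-2$ and $a\equiv b\equiv 1\bmod 2$.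
   Context: Here $i=\sqrt{-1}$. A finite complex sequence $A=[a_0,\ldots,a_{\ell-1}]$ of length $\ell$ is continued periodically with period $\ell$. Its periodic autocorrelation function is $PAF(A,s)=\sum_{j=0}^{\ell-1}a_j\overline{a_{j+s}}$, its discrete Fourier transform is $DFT(A,s)=\sum_{j=0}^{\ell-1}a_j\xi_\ell^{js}$ with $\xi_\ell=\exp(2\pi i/\ell)$, and its power spectral density is $PSD(A,s)=|DFT(A,s)|^2$, for $s=0,1,\ldots,\ell-1$ (with $\ell$ always the length of the sequence in question, so $\ell=p$ for $A_p,B_p$ and $\ell=2p$ for $A,B$). Two sequences $A,B$ of length $\ell$ form a Legendre pair $(A,B)$ if $PAF(A,s)+PAF(B,s)=-2$ for $s=1,2,\ldots,\lfloor\ell/2\rfloor$ (equivalently for $s=1,\ldots,\ell-1$). The $2$-compression of a sequence $A=[a_0,\ldots,a_{2p-1}]\in\{-1,1,-i,i\}^{2p}$ is the sequence of length $p$ with entries $a_j+a_{j+p}$, $j=0,1,\ldots,p-1$. A $2$-decompression of a sequence $S$ of length $p$ is a sequence in $\{-1,1,-i,i\}^{2p}$ whose $2$-compression is $S$. *)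

(* Defs.v *)
From mathcomp Require Export all_boot all_order all_algebra.
From mathcomp Require Export complex.
From mathcomp Require Export classical_sets cardinality reals trigo.

Set Implicit Arguments.
Unset Strict Implicit.
Unset Printing Implicit Defensive.

Import GRing.Theory Num.Theory.

(* complex_scope supplies R[i] and +i*; 'i and ^* are those of ring_scope. *)
Local Open Scope complex_scope.
Local Open Scope ring_scope.

(* Finite sequences are tuples; the entry a_n, for any n : nat, of the periodic
   continuation is read off modulo the length. *)
Definition periodic (R : realType) (l : nat) (A : l.-tuple R[i]) (n : nat) :
    R[i] :=
  A`_(n %% l).

Definition PAF (R : realType) (l : nat) (A : l.-tuple R[i]) (s : nat) : R[i] :=
  \sum_(j < l) periodic A j * (periodic A (j + s))^*.

(* exp (2 pi i / l) *)
Definition xi (R : realType) (l : nat) : R[i] :=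
  cos (2 * pi / l%:R) +i* sin (2 * pi / l%:R).

Definition DFT (R : realType) (l : nat) (A : l.-tuple R[i]) (s : nat) : R[i] :=
  \sum_(j < l) A`_j * xi R l ^+ (j * s).

(* The norm of R[i] takes its (real) values in R[i], hence so does PSD. *)
Definition PSD (R : realType) (l : nat) (A : l.-tuple R[i]) (s : nat) : R[i] :=
  `|DFT A s| ^+ 2.

Definition legendre_pair (R : realType) (l : nat) (A B : l.-tuple R[i]) : Prop :=
  forall s : nat, (1 <= s <= l %/ 2)%N -> PAF A s + PAF B s = -2.

Definition quaternary (R : realType) : seq R[i] := [:: -1; 1; - 'i; 'i].

Definition compression2 (R : realType) (m : nat) (A : (2 * m).-tuple R[i]) :
    m.-tuple R[i] :=
  [tuple A`_j + A`_(j + m) | j < m].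

Definition decompression2 (R : realType) (m : nat) (S : m.-tuple R[i])
    (A : (2 * m).-tuple R[i]) : Prop :=
  {subset A <= quaternary R} /\ compression2 A = S.

(* The Legendre symbol (j / p), meant for p an odd prime. *)
Definition legendre (p j : nat) : int :=
  if (p %| j)%N then 0
  else if [exists x : 'I_p, x ^ 2 == j %[mod p]]%N then 1 else -1.

Definition Ap (R : realType) (p : nat) : p.-tuple R[i] :=
  [tuple if val j == 0%N then 0 else 2 * (legendre p j)%:~R | j < p].

Definition Bp (R : realType) (p : nat) : p.-tuple R[i] :=
  [tuple if val j == 0%N then 1 + 'i else 0 | j < p].

(* Main.v *)
Require Import Defs.
From mathcomp Require Import cyclic finfield.
From mathcomp Require Import zify ring lra.

Set Implicit Arguments.
Unset Strict Implicit.
Unset Printing Implicit Defensive.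

Import Order.TTheory GRing.Theory Num.Theory.
Local Open Scope complex_scope.
Local Open Scope classical_set_scope.
Local Open Scope card_scope.
Local Open Scope ring_scope.

(** The autocorrelation of A_p is a character sum: for s prime to p, the sum of
    chi(j) chi(j + s) is -1 ([sum_qchar_shift], [PAF_Ap]). The Wiener-Khinchin
    formula ([PSD_sum_PAF]) turns autocorrelations into power spectral
    densities, and gives PSD (A_p, s) = 4p; the sequence B_p has one nonzero
    entry.

    The substantial part is the value of DFT (A_p, s), which is 2 chi(s) times
    the quadratic Gauss sum, including its sign. The proof is that of Gauss.
    The alternating sum of an even row of Gaussian binomial coefficients
    factors ([qbinom_altsum_even]). At a root of unity of odd order n = 2m + 1
    the coefficients of row n - 1 are signed powers of that root, and the
    factorization becomes
      sum over j < n of z^(j^2) = product over k < m of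
        (z^(2k+1) - z^-(2k+1))
    ([quadratic_sum_prod]); for n = p prime the left-hand side is the Gauss sum
    ([gauss_sum_quadratic]). For z = exp (2 pi i / p) the factors are
    2i sin (2 pi (2k+1) / p). The sines are positive for the first half of the
    indices k and negative for the second half, so that the Gauss sum is a
    nonnegative real number times 1 or i according to the parity of m, that is,
    to p modulo 4 ([gauss_sum_sign]). Its modulus is the square root of p, by
    the value of the power spectral density.

    For a sequence A of length 2p, the even frequencies see only its
    compression a_j + a_(j+p) ([DFT_even]), the odd ones only the differences
    a_j - a_(j+p) ([DFT_odd]). A sum of two fourth roots of unity that equals
    2 or -2 determines them, so a decompression of A_p is known up to a_0, and
    a_p = - a_0; its differences vanish outside j = 0. For a decompression of
    B_p the pairs are opposite, except that b_0 and b_p are 1 and i in some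
    order. In a Legendre pair the autocorrelation of B is then forced to vanish
    outside 0 and p, so Wiener-Khinchin gives PSD (B, t) = 4p - 2 for odd t. At
    t = p the transform is a Gaussian integer a + ib, because the root of unity
    is -1, and a^2 + b^2 = 4p - 2 is 2 modulo 4, which makes a and b odd. *)

(** * Sums of periodic functions *)

(** Translation by 1 moves the term of index 0 to index n, where it has the
    same value. *)
Lemma sum_periodic_shift (V : nmodType) (n : nat) (f : nat -> V) :
  (forall i, f (i %% n)%N = f i) ->
  forall k, \sum_(i < n) f (i + k)%N = \sum_(i < n) f i.
Proof.
move=> fP; elim=> [|k IHk]; first by apply: eq_bigr => i _; rewrite addn0.
rewrite -IHk; case: n fP {IHk} => [|n] fP; first by rewrite !big_ord0.
rewrite big_ord_recr big_ord_recl /= addrC add0n.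
congr (_ + _); first by rewrite -fP addnS -addSn -modnDml modnn add0n fP.
by apply: eq_bigr => i _; rewrite /bump /= addnS add1n addSn.
Qed.

(** * Gaussian binomials and the quadratic sum over a root of unity *)

Section GaussianBinomial.
Variables (F : fieldType) (x : F).

(** The q-binomial coefficients evaluated at q = x. They are defined by one of
    the two q-Pascal rules, without quotients, so that x may be a root of
    unity. *)
Fixpoint qbinom (n k : nat) {struct n} : F :=
  match n, k with
  | _, 0 => 1
  | 0, _.+1 => 0
  | n'.+1, k'.+1 => qbinom n' k + x ^+ (n' - k') * qbinom n' k'
  end.

Lemma qbinom0 n : qbinom n 0 = 1. Proof. by case: n. Qed.

Lemma qbinomS n k :
  qbinom n.+1 k.+1 = qbinom n k.+1 + x ^+ (n - k) * qbinom n k.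
Proof. by []. Qed.

Lemma qbinom_small n k : (n < k)%N -> qbinom n k = 0.
Proof.
elim: n k => [|n IHn] [|k] //= ltnk.
by rewrite !IHn ?mulr0 ?addr0 // ltnW.
Qed.

(** In terms of q-factorials both sides are the same product. By induction
    on n, either side at n.+1 equals (1 - x ^+ n.+1) times a coefficient of
    row n, by the Pascal rule and the induction hypothesis. *)
Lemma qbinom_absorb n k :
  (1 - x ^+ k.+1) * qbinom n k.+1 = (1 - x ^+ (n - k)) * qbinom n k.
Proof.
elim: n k => [|n IHn] k; first by rewrite /= sub0n expr0 subrr mul0r mulr0.
have lhs : (1 - x ^+ k.+1) * qbinom n.+1 k.+1 = (1 - x ^+ n.+1) * qbinom n k.
  have [lenk|ltnk] := leqP k n; last first.
    by rewrite qbinomS !qbinom_small ?mulr0 ?addr0 ?mulr0 // ltnW.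
  rewrite qbinomS mulrDr IHn.
  have -> : n.+1 = (k.+1 + (n - k))%N by lia.
  by rewrite exprD; ring.
rewrite lhs; case: k {lhs} => [|k]; first by rewrite !qbinom0 subn0.
have [lenk|ltnk] := ltnP k n; last first.
  rewrite qbinom_small // mulr0.
  have [->|lt] : k = n \/ (n < k)%N by lia.
    by rewrite subnn subrr mul0r.
  by rewrite qbinom_small ?mulr0.
have -> : (n.+1 - k.+1 = n - k)%N by lia.
rewrite qbinomS mulrDr mulrCA -IHn.
have -> : n.+1 = ((n - k) + k.+1)%N by lia.
by rewrite exprD; ring.
Qed.

Lemma qbinom_absorb_top n k : (k <= n)%N ->
  (1 - x ^+ (n.+1 - k)) * qbinom n.+1 k = (1 - x ^+ n.+1) * qbinom n k.
Proof.
case: k => [|k] lekn; first by rewrite !qbinom0 subn0.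
have -> : (n.+1 - k.+1 = n - k)%N by lia.
rewrite qbinomS mulrDr mulrCA -qbinom_absorb.
have -> : n.+1 = ((n - k) + k.+1)%N by lia.
by rewrite exprD; ring.
Qed.

Definition qbinom_altsum (n : nat) : F := \sum_(k < n.+1) (-1) ^+ k * qbinom n k.

(** By the Pascal rule, the sum for n.+1 arises from the one for n by weighting
    the term of index k by 1 - x ^+ (n - k); by absorption, this weight lowers
    the row of the coefficient and leaves a constant factor. *)
Lemma qbinom_altsum_rec n :
  qbinom_altsum n.+2 = (1 - x ^+ n.+1) * qbinom_altsum n.
Proof.
have step m : qbinom_altsum m.+1 =
    \sum_(k < m.+1) (-1) ^+ k * ((1 - x ^+ (m - k)) * qbinom m k).
  rewrite /qbinom_altsum big_ord_recl /= expr0 mul1r.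
  under eq_bigr => i _ do rewrite /bump /= add1n mulrDr.
  rewrite big_split /= addrA.
  under [RHS]eq_bigr => i _ do rewrite mulrBl mul1r mulrBr -mulrN.
  rewrite big_split /=; congr (_ + _); last first.
    by apply: eq_bigr => i _; rewrite exprS mulN1r mulNr mulrN.
  rewrite [RHS]big_ord_recl /= expr0 mul1r qbinom0; congr (_ + _).
  by rewrite big_ord_recr /= qbinom_small // mulr0 addr0.
rewrite step /qbinom_altsum mulr_sumr big_ord_recr /= subnn subrr mul0r mulr0 addr0.
apply: eq_bigr => i _; have lein : (i <= n)%N by rewrite -ltnS.
by rewrite (qbinom_absorb_top lein) mulrCA.
Qed.

Lemma qbinom_altsum_even m :
  qbinom_altsum m.*2 = \prod_(k < m) (1 - x ^+ k.*2.+1).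
Proof.
elim: m => [|m IHm]; first by rewrite /qbinom_altsum big_ord1 big_ord0 expr0 mul1r.
by rewrite doubleS qbinom_altsum_rec IHm big_ord_recr /= mulrC.
Qed.

End GaussianBinomial.

Section QuadraticSum.
Variables (F : fieldType) (z : F) (m : nat).
Hypothesis z_prim : (m.*2.+1).-primitive_root z.

Let zn : z ^+ m.*2.+1 = 1. Proof. exact: prim_expr_order. Qed.

Let z_unit : z \is a GRing.unit.
Proof. by apply/unitrPr; exists (z ^+ m.*2); rewrite -exprS. Qed.

(** For x = z ^- 2 of order n = m.*2.+1, the absorption ratio between
    neighbours in row n - 1 is (1 - x ^- k.+1) / (1 - x ^+ k.+1), that is,
    - x ^- k.+1 = - z ^+ (2 * k.+1). *)
Lemma qbinom_root_of_unity k : (k < m.*2.+1)%N ->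
  qbinom (z ^- 2) m.*2 k = (-1) ^+ k * z ^+ (k * k.+1).
Proof.
elim: k => [|k IHk] ltk; first by rewrite qbinom0 mul0n !expr0 mul1r.
have y_neq1 : 1 - (z ^- 2) ^+ k.+1 != 0.
  rewrite subr_eq0 eq_sym exprVn invr_eq1 -exprM -(prim_order_dvd z_prim) Gauss_dvdr.
    by rewrite gtnNdvd.
  by rewrite coprimen2 /= odd_double.
apply: (mulfI y_neq1); rewrite qbinom_absorb IHk ?(ltnW ltk) //.
have -> : (z ^- 2) ^+ (m.*2 - k) = z ^+ (2 * k.+1).
  rewrite exprVn -exprM; apply: (mulrI (unitrX (2 * (m.*2 - k)) z_unit)).
  rewrite divrr ?unitrX // -exprD.
  have -> : (2 * (m.*2 - k) + 2 * k.+1 = m.*2.+1 * 2)%N by lia.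
  by rewrite exprM zn expr1n.
have -> : (k.+1 * k.+2 = k * k.+1 + 2 * k.+1)%N by lia.
rewrite exprVn -exprM exprD exprS; field.
by rewrite expf_neq0 // -unitfE.
Qed.

(** Gauss's identity. The alternating sum of row m.*2 of the Gaussian binomials
    at z ^- 2 has the terms z ^+ (j * j.+1), and it factors by
    [qbinom_altsum_even]. Multiplication by z ^+ (m ^ 2) completes the square, as
    j ^ 2 + j + m ^ 2 is (j + m.+1) ^ 2 modulo m.*2.+1, and it makes the factors
    symmetric. *)
Lemma quadratic_sum_prod :
  \sum_(j < m.*2.+1) z ^+ (j ^ 2) =
  \prod_(k < m) (z ^+ k.*2.+1 - z ^- k.*2.+1).
Proof.
have sum_pronic : \sum_(j < m.*2.+1) z ^+ (j * j.+1) =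
    \prod_(k < m) (1 - (z ^- 2) ^+ k.*2.+1).
  rewrite -qbinom_altsum_even; apply: eq_bigr => j _.
  rewrite qbinom_root_of_unity // mulrA -exprD addnn -signr_odd odd_double.
  by rewrite expr0 mul1r.
rewrite -(@sum_periodic_shift _ _ (fun j => z ^+ (j ^ 2)) _ m.+1); last first.
  by move=> i; rewrite -(prim_expr_mod z_prim) modnXm (prim_expr_mod z_prim).
have -> : \sum_(j < m.*2.+1) z ^+ ((j + m.+1) ^ 2) =
    z ^+ (m ^ 2) * \sum_(j < m.*2.+1) z ^+ (j * j.+1).
  rewrite mulr_sumr; apply: eq_bigr => j _; rewrite -exprD.
  have -> : ((j + m.+1) ^ 2 = m ^ 2 + j * j.+1 + m.*2.+1 * j.+1)%N.
    by case: j => j _ /=; rewrite -muln2; ring.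
  by rewrite exprD [X in _ * X]exprM zn expr1n mulr1.
(* m ^ 2 is the sum of the first m odd numbers. *)
have -> : z ^+ (m ^ 2) = \prod_(k < m) z ^+ k.*2.+1.
  elim: (m) => [|k IHk]; first by rewrite big_ord0.
  rewrite big_ord_recr /= -IHk -exprD; congr (_ ^+ _); rewrite -muln2; ring.
rewrite sum_pronic -big_split /=; apply: eq_bigr => k _.
set w := z ^+ _; have w_unit : w \is a GRing.unit by rewrite unitrX.
by rewrite mulrBr mulr1 exprVn -exprM mulnC exprM invfM mulrA divrr // mul1r.
Qed.

End QuadraticSum.

(** * The quadratic character of a finite field of odd order *)

Section QuadraticCharacter.
Variable F : finFieldType.
Hypothesis oddF : odd #|F|.

Definition qchar (x : F) : int :=
  if x == 0 then 0 else if [exists y : F, y ^+ 2 == x] then 1 else -1.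

Lemma qchar0 : qchar 0 = 0. Proof. by rewrite /qchar eqxx. Qed.

Lemma card_units_even : #|F|.-1 = #|F|./2.*2.
Proof. by rewrite -{1}[#|F|]odd_double_half oddF. Qed.

Lemma finField_prim_root : exists g : F, #|F|.-1.-primitive_root g.
Proof.
have F_gt1 : (0 < #|F|.-1)%N by have := finNzRing_gt1 F; case: #|F| => [|[]].
pose units := enum (predC1 (0 : F)).
have [|||g _ g_prim] := hasP (@has_prim_root F #|F|.-1 units F_gt1 _ _ _).
- apply/allP => x; rewrite mem_enum /= => x_neq0.
  apply/unity_rootP/(mulfI x_neq0).
  by rewrite -exprS prednK ?expf_card ?mulr1 // ltnW // finNzRing_gt1.
- exact: enum_uniq.
- by rewrite -cardE cardC1.
by exists g.
Qed.

Lemma prim_root_gen (g x : F) : #|F|.-1.-primitive_root g -> x != 0 ->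
  exists k, x = g ^+ k.
Proof.
move=> g_prim x_neq0; have /(prim_rootP g_prim)[k ->] : x ^+ #|F|.-1 = 1.
  apply/(mulfI x_neq0).
  by rewrite -exprS prednK ?expf_card ?mulr1 // ltnW // finNzRing_gt1.
by exists k.
Qed.

(** As #|F|.-1 is even, the parity of a discrete logarithm is well defined,
    and the squares are the powers of even exponent. *)
Lemma qchar_prim_root g k : #|F|.-1.-primitive_root g ->
  qchar (g ^+ k) = (-1) ^+ k.
Proof.
move=> g_prim; have gn := prim_expr_order g_prim.
have g_neq0 : g != 0.
  rewrite -unitfE; apply/unitrPr; exists (g ^+ #|F|.-2); rewrite -exprS.
  by rewrite prednK // (prim_order_gt0 g_prim).
rewrite /qchar expf_eq0 (negPf g_neq0) andbF -signr_odd.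
case: existsP => [[y /eqP y2]|no_root].
  have [|l yl] := prim_root_gen (x := y) g_prim.
    by apply: contraNneq (expf_neq0 k g_neq0) => y0; rewrite -y2 y0 expr0n.
  move/eqP: y2; rewrite yl -exprM (eq_prim_root_expr g_prim).
  have even_n : (2 %| #|F|.-1)%N by rewrite card_units_even dvdn2 odd_double.
  move/eqP/(congr1 (modn^~ 2%N)); rewrite !modn_dvdm // muln2 !modn2 odd_double.
  by case: (odd k).
case odd_k: (odd k) => //; case: no_root; exists (g ^+ k./2).
by rewrite -exprM muln2 -{2}[k]odd_double_half odd_k.
Qed.

(** The square roots of 1 are 1 and -1, and half of the order of the unit group
    provides one that is not 1. *)
Lemma opp1_neq1 : -1 != 1 :> F.
Proof.
have [g g_prim] := finField_prim_root.
set m := #|F|./2; have defm : #|F|.-1 = m.*2 := card_units_even.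
have m_gt0 : (0 < m)%N by have := prim_order_gt0 g_prim; rewrite defm; lia.
apply: contraTneq (isT : true) => N1; have /eqP : (g ^+ m) ^+ 2 = 1 ^+ 2.
  by rewrite -exprM muln2 -defm (prim_expr_order g_prim) expr1n.
rewrite eqf_sqr N1 orbb -(prim_order_dvd g_prim) defm.
by rewrite gtnNdvd // -addnn -addn1 leq_add2l.
Qed.

Lemma qcharM x y : qchar (x * y) = qchar x * qchar y.
Proof.
have [->|x_neq0] := eqVneq x 0; first by rewrite mul0r qchar0 mul0r.
have [->|y_neq0] := eqVneq y 0; first by rewrite mulr0 qchar0 mulr0.
have [g g_prim] := finField_prim_root.
have [k ->] := prim_root_gen g_prim x_neq0.
have [l ->] := prim_root_gen g_prim y_neq0.
by rewrite -exprD !(qchar_prim_root _ g_prim) exprD.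
Qed.

Lemma qchar_sqr x : x != 0 -> qchar x * qchar x = 1.
Proof.
by rewrite /qchar => /negPf->; case: ifP.
Qed.

Lemma qchar1 : qchar 1 = 1.
Proof. by rewrite -[1]mulr1 qcharM qchar_sqr // oner_neq0. Qed.

(** Multiplication by a generator, which is not a square, permutes the terms
    and changes the sign of the sum. *)
Lemma sum_qchar : \sum_x qchar x = 0.
Proof.
have [g g_prim] := finField_prim_root.
have g_neq0 : g != 0.
  by apply/eqP => g0; have := qchar_prim_root 1 g_prim; rewrite g0 expr1 qchar0.
have : \sum_x qchar x = - \sum_x qchar x; last by lia.
rewrite {1}(reindex_inj (mulfI g_neq0)) -sumrN; apply: eq_bigr => x _.
by rewrite qcharM -[g]expr1 (qchar_prim_root _ g_prim) mulN1r.
Qed.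

(** For x != 0, x * (x + s) is a square times h x = 1 + s / x. With the convention
    0^-1 = 0, h is a permutation of F that sends 0 to 1, so the sum over x != 0
    of qchar (h x) is the full character sum 0 without the term qchar 1. *)
Lemma sum_qchar_shift s : s != 0 -> \sum_x qchar x * qchar (x + s) = -1.
Proof.
move=> s_neq0; pose h (x : F) := 1 + s / x.
have h_inj : injective h.
  by move=> x y /addrI /(mulfI s_neq0) /invr_inj.
have : \sum_x qchar (h x) = 0.
  by rewrite -[RHS]sum_qchar [RHS](reindex_inj h_inj).
rewrite (bigD1 0) //= [RHS](_ : _ = 1 + -1) // /h invr0 mulr0 addr0 qchar1.
move/addrI => <-; rewrite (bigD1 0) //= qchar0 mul0r add0r.
apply: eq_bigr => x x_neq0.
have -> : x + s = x * (1 + s / x) by field.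
by rewrite qcharM mulrA qchar_sqr ?mul1r.
Qed.

Lemma card_sqrt y : (#|[pred x : F | x ^+ 2 == y]|%:Z = 1 + qchar y)%R.
Proof.
rewrite /qchar; have [->|y_neq0] := eqVneq y 0.
  rewrite addr0 (_ : #|_| = 1%N) // -(card1 (0 : F)); apply: eq_card => x.
  by rewrite !inE expf_eq0.
case: existsP => [[x0 /eqP x0y]|no_root]; last first.
  by rewrite eq_card0 // => x; apply/negP => /= xy; apply: no_root; exists x.
have x0_neq0 : x0 != 0.
  by apply: contraNneq y_neq0 => x0_eq0; rewrite -x0y x0_eq0 expr0n.
have x0_neqN : x0 != - x0.
  apply/negP => /eqP x0N; case/eqP: opp1_neq1; apply: (mulfI x0_neq0).
  by rewrite mulrN mulr1 -x0N.
rewrite (@eq_card _ _ (pred2 x0 (- x0))) ?card2 ?x0_neqN // => x.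
by rewrite !inE -x0y eqf_sqr.
Qed.

Lemma sum_squares (A : pzRingType) (f : F -> A) :
  \sum_x f (x ^+ 2) = \sum_y (1 + qchar y)%:~R * f y.
Proof.
rewrite (partition_big (fun x : F => x ^+ 2) xpredT) //=; apply: eq_bigr => y _.
rewrite (eq_bigr (fun=> f y)) => [|x /eqP-> //].
by rewrite sumr_const -card_sqrt -mulr_natl.
Qed.

End QuadraticCharacter.

Section Legendre.
Variable p : nat.
Hypotheses (p_prime : prime p) (p_odd : odd p).

Lemma Fp_natr_eq (a b : nat) : (a%:R == b%:R :> 'F_p) = (a == b %[mod p]).
Proof. by rewrite -val_eqE /= !val_Fp_nat. Qed.

(** The sum over 'F_p is a sum over ordinals below a number that is only
    provably equal to p. *)
Lemma sum_Fp (V : nmodType) (f : nat -> V) :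
  \sum_(j < p) f j = \sum_(x : 'F_p) f x.
Proof. by rewrite -!(big_mkord xpredT f) Fp_cast. Qed.

Lemma legendreE j : legendre p j = qchar (j%:R : 'F_p).
Proof.
rewrite /legendre /qchar -[X in _ == X]/(0%:R) Fp_natr_eq mod0n -/(dvdn p j).
case: ifP => // _; congr (if _ then _ else _).
apply/existsP/existsP => -[x xj].
  by exists (val x)%:R; rewrite -natrX Fp_natr_eq.
have x_ltp : (x < p)%N by rewrite -[p in (_ < p)%N]Fp_cast // ltn_ord.
by exists (Ordinal x_ltp); rewrite -Fp_natr_eq natrX natr_Zp.
Qed.

End Legendre.

(** * The roots of unity exp (2 pi i / l) *)

Section RootOfUnity.
Variable R : realType.
Implicit Types (l k : nat).

Lemma cos_sin_exp (t : R) k :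
  (cos t +i* sin t) ^+ k = cos (k%:R * t) +i* sin (k%:R * t).
Proof.
elim: k => [|k IHk]; first by rewrite mul0r cos0 sin0.
rewrite exprS IHk -natr1 mulrDl mul1r [k%:R * t + t]addrC cosD sinD.
by apply/eqP; rewrite eq_complex /= eqxx addrC eqxx.
Qed.

Lemma xi_exp l k : xi R l ^+ k =
  cos (k%:R * (2 * pi / l%:R)) +i* sin (k%:R * (2 * pi / l%:R)).
Proof. exact: cos_sin_exp. Qed.

Lemma norm_xi l : `|xi R l| = 1.
Proof. by rewrite normc_def /= cos2Dsin2 sqrtr1. Qed.

Lemma xi_neq0 l : xi R l != 0.
Proof. by rewrite -normr_eq0 norm_xi oner_neq0. Qed.

Lemma conj_xi_exp l k : (xi R l ^+ k)^* = xi R l ^- k.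
Proof. by rewrite invC_norm normrX norm_xi !expr1n invr1 mul1r. Qed.

Lemma xi_half m : (0 < m)%N -> xi R (2 * m) ^+ m = -1.
Proof.
move=> m_gt0; have m_neq0 : m%:R != 0 :> R by rewrite pnatr_eq0 -lt0n.
rewrite xi_exp (_ : _ * _ = pi); last by rewrite natrM; field.
by rewrite cospi sinpi; apply/eqP; rewrite eq_complex /= oppr0 !eqxx.
Qed.

Lemma xi_double m : (0 < m)%N -> xi R (2 * m) ^+ 2 = xi R m.
Proof.
move=> m_gt0; have m_neq0 : m%:R != 0 :> R by rewrite pnatr_eq0 -lt0n.
by rewrite xi_exp /xi (_ : _ * _ = 2 * pi / m%:R) // natrM; field.
Qed.

Lemma xi_order l : (0 < l)%N -> xi R l ^+ l = 1.
Proof.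
by move=> l_gt0; rewrite -xi_double // exprAC xi_half // sqrrN expr1n.
Qed.

Lemma xi_exp_neq1 l k : (0 < k < l)%N -> xi R l ^+ k != 1.
Proof.
move=> /andP[k_gt0 k_ltl]; have l_gt0 : (0 < l)%N by apply: ltn_trans k_ltl.
have l_neq0 : l%:R != 0 :> R by rewrite pnatr_eq0 -lt0n.
(* exp (2it) - 1 has real part - 2 sin t ^ 2, and t = pi k / l lies strictly
   between 0 and pi. *)
pose t : R := k%:R / l%:R * pi.
have t_bounds : 0 < t < pi.
  rewrite /t mulr_gt0 ?pi_gt0 ?divr_gt0 ?ltr0n //=.
  by rewrite -[ltRHS]mul1r ltr_pM2r ?pi_gt0 // ltr_pdivrMr ?ltr0n // mul1r ltr_nat.
rewrite xi_exp (_ : _ * _ = t *+ 2); last by rewrite /t mulr2n; field.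
rewrite eq_complex /= cos_mulr2n cos2sin2 negb_and; apply/orP; left.
have := sin_gt0_pi t_bounds; have : 0 < sin t -> 0 < sin t ^+ 2 by apply: exprn_gt0.
move=> sq /sq; rewrite -mulr_natl; lra.
Qed.

Lemma xi_prim_root l : (0 < l)%N -> l.-primitive_root (xi R l).
Proof.
move=> l_gt0; rewrite /primitive_root_of_unity l_gt0; apply/forallP => k /=.
rewrite unity_rootE; case: (ltngtP k.+1 l) => [ltkl|ltlk|->] /=.
- by rewrite (negPf (xi_exp_neq1 _)) ?ltkl.
- by have := ltn_ord k; rewrite ltnNge -ltnS ltlk.
- by rewrite xi_order ?eqxx.
Qed.

Lemma sum_xi l s : ~~ (l %| s)%N -> \sum_(j < l) xi R l ^+ (j * s) = 0.
Proof.
case: l => [|l]; first by rewrite big_ord0.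
rewrite (prim_order_dvd (xi_prim_root _)) // -subr_eq0 => w_neq1.
apply: (mulfI w_neq1); rewrite mulr0.
under eq_bigr => j _ do rewrite mulnC exprM.
by rewrite -subrX1 exprAC xi_order // expr1n subrr.
Qed.

End RootOfUnity.

(** * Autocorrelation and power spectral density *)

Section Autocorrelation.
Variables (R : realType) (l : nat).
Hypothesis l_gt0 : (0 < l)%N.
Implicit Types (A : l.-tuple R[i]) (s t : nat).

Lemma periodic_mod A i : periodic A (i %% l) = periodic A i.
Proof. by rewrite /periodic modn_mod. Qed.

Lemma periodic_small A i : (i < l)%N -> periodic A i = A`_i.
Proof. by move=> ltil; rewrite /periodic modn_small. Qed.

Lemma periodicDl A i : periodic A (i + l) = periodic A i.
Proof. by rewrite -periodic_mod modnDr periodic_mod. Qed.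

Lemma DFT_periodic A s :
  DFT A s = \sum_(j < l) periodic A j * xi R l ^+ (j * s).
Proof. by apply: eq_bigr => j _; rewrite periodic_small. Qed.

(** Substitute j + s for j. *)
Lemma PAF_sub A s : (s <= l)%N -> PAF A (l - s) = (PAF A s)^*.
Proof.
move=> lesl; rewrite /PAF rmorph_sum /=.
pose f i := periodic A i * (periodic A (i + (l - s)))^*.
rewrite -(@sum_periodic_shift _ _ f _ s) => [|i]; last first.
  by rewrite /f periodic_mod -[periodic A (_ + _)]periodic_mod modnDml periodic_mod.
apply: eq_bigr => j _; rewrite /f rmorphM /= conjCK mulrC; congr (_^* * _).
by rewrite -addnA subnKC // periodicDl.
Qed.

(** The Wiener-Khinchin formula: expand the square of the modulus and substitute
    i = j + t. *)
Lemma PSD_sum_PAF A s :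
  PSD A s = \sum_(t < l) PAF A t * xi R l ^- (t * s).
Proof.
have xiM i : xi R l ^+ (i %% l) = xi R l ^+ i.
  exact: prim_expr_mod (xi_prim_root R l_gt0) i.
rewrite /PSD normCK DFT_periodic rmorph_sum /= mulr_suml.
under [RHS]eq_bigr => t _ do rewrite /PAF mulr_suml.
rewrite exchange_big /=; apply: eq_bigr => j _; rewrite mulr_sumr.
pose f i := periodic A j * xi R l ^+ (j * s) *
   (periodic A i * xi R l ^+ (i * s))^*.
rewrite (eq_bigr (fun i : 'I_l => f i)) // -(@sum_periodic_shift _ _ f _ j).
  apply: eq_bigr => t _; rewrite /f rmorphM /= conj_xi_exp addnC mulnDl exprD.
  rewrite invfM; set w := xi R l ^+ (j * s); set v := xi R l ^- _.
  have w_neq0 : w != 0 by rewrite expf_neq0 // xi_neq0.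
  by rewrite -!mulrA; congr (_ * _); rewrite mulrCA; congr (_ * _); field.
by move=> i; rewrite /f periodic_mod -[xi R l ^+ (_ %% _ * _)]xiM modnMml xiM.
Qed.

End Autocorrelation.

(** * The Legendre symbol and its Gauss sum *)

Lemma ord_ndvd p (p_gt0 : (0 < p)%N) (j : 'I_p) :
  j != Ordinal p_gt0 -> ~~ (p %| j)%N.
Proof.
by apply: contra => dv; rewrite -val_eqE /= -(modn_small (ltn_ord j)).
Qed.

Section LegendreSums.
Variable p : nat.
Hypotheses (p_prime : prime p) (p_odd : odd p).

Let p_gt0 : (0 < p)%N. Proof. exact: prime_gt0. Qed.

Let oddFp : odd #|'F_p|. Proof. by rewrite card_Fp. Qed.

Lemma legendre_mod j : legendre p (j %% p) = legendre p j.
Proof.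
rewrite !legendreE //; congr qchar.
by apply/eqP; rewrite Fp_natr_eq // modn_mod.
Qed.

Lemma legendreDr j : legendre p (j + p) = legendre p j.
Proof. by rewrite -legendre_mod modnDr legendre_mod. Qed.

Lemma legendre_dvd j : (p %| j)%N -> legendre p j = 0.
Proof. by rewrite /legendre => ->. Qed.

Lemma legendre_pm1 j : ~~ (p %| j)%N -> legendre p j = 1 \/ legendre p j = -1.
Proof. by rewrite /legendre => /negPf->; case: ifP; [left|right]. Qed.

Lemma sum_legendre_shift s : ~~ (p %| s)%N ->
  \sum_(j < p) legendre p j * legendre p (j + s) = -1.
Proof.
move=> ndvd; have s_neq0 : s%:R != 0 :> 'F_p.
  by rewrite -[X in _ != X]/(0%:R) Fp_natr_eq // mod0n.
rewrite (sum_Fp p_prime (fun j => legendre p j * legendre p (j + s))).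
rewrite -(sum_qchar_shift oddFp s_neq0); apply: eq_bigr => x _.
by rewrite !legendreE // natrD natr_Zp.
Qed.

Section GaussSum.
Variables (F : fieldType) (z : F).
Hypothesis z_prim : p.-primitive_root z.

Definition gauss_sum : F := \sum_(j < p) (legendre p j)%:~R * z ^+ j.

(** Substitute j * s for j in the Gauss sum. *)
Lemma gauss_sum_scale s : ~~ (p %| s)%N ->
  \sum_(j < p) (legendre p j)%:~R * z ^+ (j * s) =
  (legendre p s)%:~R * gauss_sum.
Proof.
move=> ndvd; have s_neq0 : s%:R != 0 :> 'F_p.
  by rewrite -[X in _ != X]/(0%:R) Fp_natr_eq // mod0n.
rewrite /gauss_sum.
rewrite (sum_Fp p_prime (fun j => (legendre p j)%:~R * z ^+ (j * s))).
rewrite (sum_Fp p_prime (fun j => (legendre p j)%:~R * z ^+ j)).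
rewrite [in RHS](reindex_inj (mulIf s_neq0)) mulr_sumr; apply: eq_bigr => x _.
rewrite mulrA -intrM !legendreE // !natr_Zp qcharM // mulrCA qchar_sqr // mulr1.
rewrite -[in RHS](natr_Zp x) -natrM val_Fp_nat // [in RHS](prim_expr_mod z_prim).
by rewrite natr_Zp.
Qed.

(** Add the vanishing sum of all z ^+ j: then z ^+ y has the coefficient
    1 + (y / p), the number of square roots of y. *)
Lemma gauss_sum_quadratic : gauss_sum = \sum_(j < p) z ^+ (j ^ 2).
Proof.
have z_sum0 : \sum_(j < p) z ^+ j = 0.
  have z_neq1 : z - 1 != 0.
    rewrite subr_eq0 -[z]expr1 -(prim_order_dvd z_prim) dvdn1.
    by rewrite neq_ltn prime_gt1 ?orbT.
  by apply: (mulfI z_neq1); rewrite -subrX1 (prim_expr_order z_prim) subrr mulr0.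
transitivity (\sum_(j < p) z ^+ j + gauss_sum); first by rewrite z_sum0 add0r.
rewrite /gauss_sum -big_split /=.
rewrite (sum_Fp p_prime (fun j => z ^+ j + (legendre p j)%:~R * z ^+ j)).
rewrite (sum_Fp p_prime (fun j => z ^+ (j ^ 2))).
transitivity (\sum_(y : 'F_p) (1 + qchar y)%:~R * z ^+ y).
  by apply: eq_bigr => y _; rewrite legendreE // natr_Zp rmorphD /= mulrDl mul1r.
rewrite -(sum_squares oddFp (fun y : 'F_p => z ^+ y)); apply: eq_bigr => x _.
by rewrite -[in LHS](natr_Zp x) -natrX val_Fp_nat // (prim_expr_mod z_prim).
Qed.

Lemma gauss_sum_prod :
  gauss_sum = \prod_(k < p./2) (z ^+ k.*2.+1 - z ^- k.*2.+1).
Proof.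
have defp : p = p./2.*2.+1 by rewrite -{1}[p]odd_double_half p_odd.
by rewrite gauss_sum_quadratic -quadratic_sum_prod -defp.
Qed.

End GaussSum.
End LegendreSums.

(** * The sign of the Gauss sum *)

Section ComplexGaussSum.
Variables (R : realType) (p : nat).
Hypotheses (p_prime : prime p) (p_odd : odd p).

Let p_gt0 : (0 < p)%N. Proof. exact: prime_gt0. Qed.
Let p_gt1 : (1 < p)%N. Proof. exact: prime_gt1. Qed.

Lemma xi_sub_inv k : xi R p ^+ k - xi R p ^- k =
  'i * (2 * sin (k%:R * (2 * pi / p%:R)))%:C.
Proof.
rewrite -conj_xi_exp xi_exp -complexiE; set c := cos _; set s := sin _.
rewrite (_ : (c +i* s)^* = c -i* s) //.
by apply/eqP; rewrite eq_complex /=; apply/andP; split; apply/eqP; ring.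
Qed.

Let angle k : k%:R * (2 * pi / p%:R) = (2 * k)%:R / p%:R * pi :> R.
Proof.
have p_neq0 : p%:R != 0 :> R by rewrite pnatr_eq0 -lt0n.
by rewrite natrM; field.
Qed.

Lemma sin_frac_gt0 a b : (0 < a < b)%N -> 0 < sin (a%:R / b%:R * pi) :> R.
Proof.
move=> /andP[a_gt0 ltab]; have b_gt0 := leq_ltn_trans (leq0n a) ltab.
apply: sin_gt0_pi; rewrite mulr_gt0 ?pi_gt0 ?divr_gt0 ?ltr0n //=.
by rewrite -[ltRHS]mul1r ltr_pM2r ?pi_gt0 // ltr_pdivrMr ?ltr0n // mul1r ltr_nat.
Qed.

Lemma sin_xi_gt0 k : (0 < 2 * k < p)%N -> 0 < sin (k%:R * (2 * pi / p%:R)) :> R.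
Proof. by move=> bounds; rewrite angle sin_frac_gt0. Qed.

Lemma sin_xi_lt0 k : (p < 2 * k < 2 * p)%N ->
  sin (k%:R * (2 * pi / p%:R)) < 0 :> R.
Proof.
move=> /andP[lo hi]; rewrite angle.
have -> : (2 * k)%:R / p%:R * pi = (2 * k - p)%:R / p%:R * pi + pi :> R.
  have p_neq0 : p%:R != 0 :> R by rewrite pnatr_eq0 -lt0n.
  by rewrite natrB 1?ltnW //; field.
by rewrite sinDpi oppr_lt0 sin_frac_gt0 //; lia.
Qed.

(** Each factor of [gauss_sum_prod] is 'i or - 'i times a nonnegative number,
    according to the sign of a sine. With m = p./2, the factor - 'i occurs m./2
    times among the m factors, and 'i * - 'i = 1, which leaves a single 'i when m
    is odd. *)
Lemma gauss_sum_sign : exists2 r : R[i], 0 <= r &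
  gauss_sum p (xi R p) = 'i ^+ odd p./2 * r.
Proof.
set m := p./2; have defp : p = m.*2.+1 by rewrite -{1}[p]odd_double_half p_odd.
rewrite gauss_sum_prod ?xi_prim_root // -/m.
pose r k : R[i] := `|2 * sin (k.*2.+1%:R * (2 * pi / p%:R))|%:C.
have r_ge0 k : 0 <= r k by rewrite /r ler0c normr_ge0.
exists (\prod_(k < m) r k); first by apply: prodr_ge0.
(* The angle of the factor k lies in the upper half circle for the first
   uphalf m values of k, and in the lower one for the other m./2. *)
have factor k : (k < m)%N -> xi R p ^+ k.*2.+1 - xi R p ^- k.*2.+1 =
    (if (k < uphalf m)%N then 'i else - 'i) * r k.
  move=> ltkm; rewrite xi_sub_inv /r; case: ltnP => k_m.
    by rewrite ger0_norm // mulr_ge0 // ltW // sin_xi_gt0 //; lia.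
  rewrite ler0_norm ?rmorphN ?mulrNN // pmulr_rle0 // ltW // sin_xi_lt0 //; lia.
rewrite (eq_bigr (fun k : 'I_m =>
  (if (k < uphalf m)%N then 'i else - 'i) * r k)) => [|k _]; last exact: factor.
rewrite big_split /=; congr (_ * _).
have -> : m = (uphalf m + m./2)%N by lia.
rewrite big_split_ord /=.
have -> : (uphalf m + m./2 = m)%N by lia.
rewrite (eq_bigr (fun=> 'i)) => [|k _]; last by rewrite ltn_ord.
rewrite [X in _ * X](eq_bigr (fun=> - 'i)) => [|k _]; last first.
  by rewrite ltnNge leq_addr.
rewrite !prodr_const !card_ord uphalf_half exprD -mulrA -exprMn mulrN -expr2 sqrCi.
by rewrite opprK expr1n mulr1.
Qed.

(** * The sequences A_p and B_p *)

Lemma periodic_Ap n : periodic (Ap R p) n = 2 * (legendre p n)%:~R.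
Proof.
have lt_np : (n %% p < p)%N by rewrite ltn_mod.
rewrite /periodic -[(n %% p)%N]/(val (Ordinal lt_np)) -tnth_nth tnth_mktuple /=.
by case: eqP => [/eqP n0|_]; rewrite ?legendre_mod // legendre_dvd ?mulr0.
Qed.

Lemma periodic_Bp n :
  periodic (Bp R p) n = if (p %| n)%N then 1 + 'i else 0.
Proof.
have lt_np : (n %% p < p)%N by rewrite ltn_mod.
by rewrite /periodic -[(n %% p)%N]/(val (Ordinal lt_np)) -tnth_nth tnth_mktuple.
Qed.

Lemma legendre_conj n : ((legendre p n)%:~R : R[i])^* = (legendre p n)%:~R.
Proof. by rewrite rmorph_int. Qed.

Lemma PAF_Ap0 : PAF (Ap R p) 0 = 4 * (p%:R - 1).
Proof.
rewrite /PAF (bigD1 (Ordinal p_gt0)) //= periodic_Ap legendre_dvd // mulr0 mul0r add0r.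
rewrite (eq_bigr (fun=> 4)) => [|j j_neq0].
  rewrite sumr_const cardC1 card_ord -[_ *+ p.-1]mulr_natr; congr (_ * _).
  by rewrite -subn1 natrB.
rewrite addn0 periodic_Ap rmorphM /= legendre_conj conjC_nat.
have ndvd := ord_ndvd j_neq0.
by case: (legendre_pm1 ndvd) => ->; ring.
Qed.

Lemma PAF_Ap s : ~~ (p %| s)%N -> PAF (Ap R p) s = -4.
Proof.
move=> ndvd; rewrite (_ : -4 = 4 * (-1)%:~R); last by ring.
rewrite -(sum_legendre_shift p_prime p_odd ndvd) rmorph_sum /= mulr_sumr.
apply: eq_bigr => j _.
by rewrite !periodic_Ap rmorphM /= legendre_conj conjC_nat rmorphM /=; ring.
Qed.

(** The autocorrelation is 4p times the indicator of 0, minus 4, and the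
    constant -4 contributes nothing at a frequency s prime to p. *)
Lemma PSD_Ap s : ~~ (p %| s)%N -> PSD (Ap R p) s = 4 * p%:R.
Proof.
move=> ndvd; rewrite PSD_sum_PAF // (bigD1 (Ordinal p_gt0)) //= PAF_Ap0.
rewrite mul0n expr0 invr1 mulr1.
have := sum_xi R ndvd; rewrite (bigD1 (Ordinal p_gt0)) //= mul0n expr0.
move/(congr1 Num.conj); rewrite rmorphD rmorph0 rmorph1 rmorph_sum /= => /eqP.
rewrite addrC addr_eq0 => /eqP sum_rest.
rewrite (eq_bigr (fun j : 'I_p => -4 * (xi R p ^+ (j * s))^*)) => [|j j_neq0].
  by rewrite -mulr_sumr sum_rest; ring.
rewrite conj_xi_exp PAF_Ap //.
exact: ord_ndvd j_neq0.
Qed.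

Lemma DFT_Ap_gauss_sum s : ~~ (p %| s)%N ->
  DFT (Ap R p) s = 2 * ((legendre p s)%:~R * gauss_sum p (xi R p)).
Proof.
move=> ndvd; rewrite -gauss_sum_scale ?xi_prim_root // DFT_periodic mulr_sumr.
by apply: eq_bigr => j _; rewrite periodic_Ap mulrA.
Qed.

(** [gauss_sum_sign] leaves only the absolute value, which [PSD_Ap] provides at
    frequency 1. *)
Lemma gauss_sum_xi :
  gauss_sum p (xi R p) = 'i ^+ odd p./2 * (Num.sqrt (p%:R : R))%:C.
Proof.
have [r r_ge0 Gr] := gauss_sum_sign; rewrite Gr; congr (_ * _).
have ndvd1 : ~~ (p %| 1)%N by rewrite gtnNdvd.
apply/eqP; rewrite -(eqrXn2 (n := 2)) // ?ler0c ?sqrtr_ge0 //.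
rewrite -rmorphXn /= sqr_sqrtr ?ler0n // rmorph_nat.
have := PSD_Ap ndvd1; rewrite /PSD DFT_Ap_gauss_sum // Gr !normrM normrX normCi expr1n.
rewrite mul1r ger0_norm // (ger0_norm r_ge0) => pr.
apply/eqP; apply: (mulfI (x := 4)); first by rewrite pnatr_eq0.
rewrite -pr; case: (legendre_pm1 ndvd1) => ->; rewrite ?rmorphN1 ?normrN ?normr1; ring.
Qed.

Lemma DFT_Ap s : ~~ (p %| s)%N ->
  DFT (Ap R p) s =
    2 * (legendre p s)%:~R * ('i ^+ odd p./2 * (Num.sqrt (p%:R : R))%:C).
Proof. by move=> ndvd; rewrite DFT_Ap_gauss_sum // gauss_sum_xi mulrA. Qed.

Lemma DFT_Bp s : DFT (Bp R p) s = 1 + 'i.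
Proof.
rewrite DFT_periodic (bigD1 (Ordinal p_gt0)) //= periodic_Bp dvdn0 mul0n mulr1.
rewrite big1 ?addr0 // => j j_neq0; rewrite periodic_Bp ifN ?mul0r //.
exact: ord_ndvd j_neq0.
Qed.

Lemma norm_1Di_sqr : `|1 + 'i : R[i]| ^+ 2 = 2.
Proof.
rewrite normCK rmorphD /= conjCi rmorph1 (_ : _ * _ = 1 - 'i ^+ 2); last by ring.
by rewrite sqrCi opprK.
Qed.

Lemma PSD_Bp s : PSD (Bp R p) s = 2.
Proof. by rewrite /PSD DFT_Bp norm_1Di_sqr. Qed.

Lemma PAF_Bp s : PAF (Bp R p) s = if (p %| s)%N then 2 else 0.
Proof.
rewrite /PAF (bigD1 (Ordinal p_gt0)) //= !periodic_Bp dvdn0 add0n.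
rewrite big1 ?addr0 => [|j j_neq0].
  by case: ifP => _; rewrite ?rmorph0 ?mulr0 // -normCK norm_1Di_sqr.
rewrite periodic_Bp ifN ?mul0r //.
exact: ord_ndvd j_neq0.
Qed.

End ComplexGaussSum.

(** * Quaternary numbers *)

Section Quaternary.
Variable R : realType.
Implicit Types x y : R[i].

Lemma quaternaryP x : reflect [\/ x = -1, x = 1, x = - 'i | x = 'i]
  (x \in quaternary R).
Proof.
rewrite !inE; apply: (iffP or4P) => -[] => [/eqP|/eqP|/eqP|/eqP|->|->|->|->];
  by [constructor 1|constructor 2|constructor 3|constructor 4].
Qed.

Lemma norm_quaternary x : x \in quaternary R -> `|x| = 1.
Proof. by case/quaternaryP => ->; rewrite ?normrN ?normr1 ?normCi. Qed.

(** Two numbers of modulus 1 whose sum has modulus 2 coincide; among fourth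
    roots of unity this is a comparison of real and imaginary parts. *)
Lemma quaternary_add_pm2 x y (c : int) : x \in quaternary R -> y \in quaternary R ->
  c = 1 \/ c = -1 -> x + y = 2 * c%:~R -> x = c%:~R /\ y = c%:~R.
Proof.
case/quaternaryP=> ->; case/quaternaryP=> ->; case=> ->; rewrite -?complexiE // =>
  /eqP; rewrite eq_complex /= => /andP[/eqP e1 /eqP e2]; exfalso; lra.
Qed.

Lemma quaternary_add_1Di x y : x \in quaternary R -> y \in quaternary R ->
  x + y = 1 + 'i -> (x = 1 /\ y = 'i) \/ (x = 'i /\ y = 1).
Proof.
case/quaternaryP=> ->; case/quaternaryP=> ->; rewrite -?complexiE; do ?by [left|right];
  move/eqP; rewrite eq_complex /= => /andP[/eqP e1 /eqP e2]; exfalso; lra.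
Qed.

Lemma uniq_quaternary : uniq (quaternary R).
Proof.
rewrite /quaternary -complexiE /= !inE !eq_complex /=.
rewrite !negb_or !negb_and.
have lr (a b : R) : a < b -> a != b by move=> ltab; rewrite lt_eqF.
have rl (a b : R) : b < a -> a != b by move=> ltab; rewrite gt_eqF.
repeat (apply/andP; split) => //; apply/orP;
  solve [left; solve [apply: lr; lra|apply: rl; lra]
        |right; solve [apply: lr; lra|apply: rl; lra]].
Qed.

End Quaternary.

(** * Sequences of even length and their compressions *)

Section Compression.
Variables (R : realType) (m : nat).
Hypothesis m_gt0 : (0 < m)%N.
Implicit Types (A : (2 * m).-tuple R[i]) (s t : nat).

Let dm_gt0 : (0 < 2 * m)%N. Proof. by rewrite muln_gt0. Qed.

Lemma sum_double (V : nmodType) (f : nat -> V) :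
  \sum_(j < 2 * m) f j = \sum_(j < m) (f j + f (j + m)%N).
Proof.
rewrite mul2n -addnn big_split_ord big_split /=; congr (_ + _).
by apply: eq_bigr => j _; rewrite addnC.
Qed.

Lemma nth_compression2 A j : (j < m)%N ->
  (compression2 A)`_j = A`_j + A`_(j + m).
Proof.
move=> ltjm; rewrite -[j in LHS]/(val (Ordinal ltjm)) -tnth_nth tnth_mktuple.
by [].
Qed.

Lemma periodic_compression2 A j :
  periodic (compression2 A) j = periodic A j + periodic A (j + m).
Proof.
have shift q i : periodic A (i + q * m) + periodic A (i + q * m + m) =
    periodic A i + periodic A (i + m).
  elim: q => [|q IHq]; first by rewrite addn0.
  rewrite [(q.+1 * m)%N]mulSnr addnA addrC -IHq; congr (_ + _).
  by rewrite -addnA addnn -mul2n periodicDl.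
rewrite {2 3}(divn_eq j m) [(_ * _ + _)%N]addnC shift.
have lt_jm : (j %% m < m)%N by rewrite ltn_mod.
by rewrite [LHS]nth_compression2 // !periodic_small //; lia.
Qed.

(** At an even frequency 2 * s the indices j and j + m carry the same root of
    unity, which is (xi m) ^+ (j * s). *)
Lemma DFT_even A s : DFT A (2 * s) = DFT (compression2 A) s.
Proof.
rewrite !DFT_periodic.
rewrite (sum_double (fun j => periodic A j * xi R (2 * m) ^+ (j * (2 * s)))).
apply: eq_bigr => j _; rewrite periodic_compression2 mulrDl.
have xi2 i : xi R (2 * m) ^+ (i * (2 * s)) = xi R m ^+ (i * s).
  by rewrite mulnCA exprM xi_double.
by rewrite !xi2 mulnDl exprD [xi R m ^+ (m * s)]exprM xi_order // expr1n mulr1.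
Qed.

Lemma PSD_even A s : PSD A (2 * s) = PSD (compression2 A) s.
Proof. by rewrite /PSD DFT_even. Qed.

(** At an odd frequency the indices j and j + m carry opposite roots of unity. *)
Lemma DFT_odd A t : odd t -> DFT A t =
  \sum_(j < m) (periodic A j - periodic A (j + m)) * xi R (2 * m) ^+ (j * t).
Proof.
move=> t_odd; rewrite DFT_periodic.
rewrite (sum_double (fun j => periodic A j * xi R (2 * m) ^+ (j * t))).
apply: eq_bigr => j _; rewrite mulrBl mulnDl exprD [xi R _ ^+ (m * t)]exprM.
by rewrite xi_half // -signr_odd t_odd expr1 mulrN1 mulrN.
Qed.

Lemma PAF_half A s : PAF A s = \sum_(j < m)
  (periodic A j * (periodic A (j + s))^* +
   periodic A (j + m) * (periodic A (j + m + s))^*).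
Proof. exact: (sum_double (fun j => periodic A j * (periodic A (j + s))^*)). Qed.

Lemma quaternary_periodic A j : {subset A <= quaternary R} ->
  periodic A j \in quaternary R.
Proof. by move=> A_quat; apply/A_quat/mem_nth; rewrite size_tuple ltn_mod. Qed.

Lemma PAF0_quaternary A : {subset A <= quaternary R} -> PAF A 0 = 2 * m%:R.
Proof.
move=> A_quat; rewrite /PAF (eq_bigr (fun=> 1)) => [|j _].
  by rewrite sumr_const card_ord natrM.
by rewrite addn0 -normCK norm_quaternary ?expr1n // quaternary_periodic.
Qed.

End Compression.

(** * The 2-decompressions of A_p and B_p *)

Section Decompression.
Variables (R : realType) (p : nat).
Hypotheses (p_prime : prime p) (p_odd : odd p).

Let p_gt0 : (0 < p)%N. Proof. exact: prime_gt0. Qed.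
Let chi (j : nat) : R[i] := (legendre p j)%:~R.

Let ndvd_small j : (1 <= j <= p - 1)%N -> ~~ (p %| j)%N.
Proof. by move=> /andP[j1 j2]; rewrite gtnNdvd //; lia. Qed.

Section OfAp.
Variable A : (2 * p).-tuple R[i].
Hypothesis A_dec : decompression2 (Ap R p) A.

Lemma decompression_Ap_sum j : periodic A j + periodic A (j + p) = 2 * chi j.
Proof. by rewrite -periodic_compression2 // A_dec.2 periodic_Ap. Qed.

Lemma decompression_Ap_dvd j : (p %| j)%N -> periodic A (j + p) = - periodic A j.
Proof.
move=> dv; apply/eqP; rewrite -addr_eq0 addrC decompression_Ap_sum.
by rewrite /chi legendre_dvd // mulr0.
Qed.

Lemma decompression_Ap_ndvd j : ~~ (p %| j)%N -> periodic A j = chi j.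
Proof.
move=> ndvd; have quat i := quaternary_periodic p_gt0 i A_dec.1.
by have [] := quaternary_add_pm2 (quat j) (quat (j + p)%N) (legendre_pm1 ndvd)
  (decompression_Ap_sum j).
Qed.

(** The pair of terms j, j + p contributes 2 chi(j) chi(j + s). If p does not
    divide j, the factor a_j = a_(j + p) = chi(j) comes out and the other factors
    add up to 2 chi(j + s); if p divides j, the factor chi(s) comes out and the
    others, a_j and - a_j, cancel. *)
Lemma PAF_decompression_Ap s : ~~ (p %| s)%N -> PAF A s = -2.
Proof.
move=> ndvd; rewrite PAF_half //.
transitivity
  (2 * (\sum_(j < p) legendre p j * legendre p (j + s))%:~R : R[i]); last first.
  by rewrite sum_legendre_shift //; ring.
rewrite rmorph_sum mulr_sumr; apply: eq_bigr => j _.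
rewrite /= intrM -/(chi _) -/(chi (j + s)).
have chi_conj i : (chi i)^* = chi i by rewrite /chi rmorph_int.
have [dv|ndv] := boolP (p %| j)%N.
  have ndv_js : ~~ (p %| j + s)%N by rewrite dvdn_addr.
  have ndv_jps : ~~ (p %| j + p + s)%N by rewrite addnAC dvdn_addl.
  rewrite decompression_Ap_dvd //.
  rewrite !(decompression_Ap_ndvd ndv_js, decompression_Ap_ndvd ndv_jps).
  by rewrite /chi addnAC legendreDr // (legendre_dvd dv); ring.
have ndv_jp : ~~ (p %| j + p)%N by rewrite dvdn_addl.
rewrite !(decompression_Ap_ndvd ndv, decompression_Ap_ndvd ndv_jp) addnAC.
rewrite [chi (j + p)](_ : _ = chi j); last first.
  by rewrite /chi legendreDr.
rewrite -mulrDr -rmorphD /= decompression_Ap_sum rmorphM /= chi_conj conjC_nat.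
by ring.
Qed.

Lemma PAFp_decompression_Ap : PAF A p = 2 * p%:R - 4.
Proof.
have quat i := quaternary_periodic p_gt0 i A_dec.1.
rewrite PAF_half // (bigD1 (Ordinal p_gt0)) //=.
rewrite (eq_bigr (fun=> 2)) => [|j /ord_ndvd ndv].
  rewrite sumr_const cardC1 card_ord -[_ *+ p.-1]mulr_natr -subn1 natrB //.
  rewrite -!addnA decompression_Ap_dvd ?dvdn0 //.
  rewrite addnn -mul2n periodicDl !rmorphN /= mulrN mulNr -normCK.
  by rewrite norm_quaternary ?expr1n //; ring.
rewrite -addnA addnn -mul2n periodicDl.
have ndv_jp : ~~ (p %| j + p)%N by rewrite dvdn_addl.
rewrite !decompression_Ap_ndvd // /chi legendreDr // rmorph_int.
by case: (legendre_pm1 ndv) => ->; ring.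
Qed.

Lemma DFT_odd_decompression_Ap t : odd t -> DFT A t = 2 * A`_0.
Proof.
move=> t_odd; rewrite DFT_odd // (bigD1 (Ordinal p_gt0)) //=.
rewrite decompression_Ap_dvd ?dvdn0 // periodic_small ?muln_gt0 //.
rewrite big1 => [|j /ord_ndvd ndv]; first by rewrite mul0n expr0; ring.
have ndv_jp : ~~ (p %| j + p)%N by rewrite dvdn_addl.
by rewrite !decompression_Ap_ndvd // /chi legendreDr // subrr mul0r.
Qed.

End OfAp.

Lemma decompression_ApP (A : (2 * p).-tuple R[i]) :
  decompression2 (Ap R p) A <->
  [/\ A`_p = - A`_0, A`_0 \in quaternary R &
    forall j : nat, (1 <= j <= p - 1)%N -> A`_j = chi j /\ A`_(j + p) = chi j].
Proof.
split=> [A_dec|[Ap0 A0 Achi]].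
  have small i : (i < 2 * p)%N -> periodic A i = A`_i := @periodic_small _ _ A i.
  split=> [||j j_bounds].
  - rewrite -!small ?muln_gt0 //; last by lia.
    exact: (decompression_Ap_dvd A_dec (dvdn0 p)).
  - by rewrite -small ?muln_gt0 //; apply: quaternary_periodic A_dec.1.
  - have ndv := ndvd_small j_bounds.
    have ndv_jp : ~~ (p %| j + p)%N by rewrite dvdn_addl.
    rewrite -!small; try lia; rewrite !(decompression_Ap_ndvd A_dec) //; split=> //.
    by rewrite /chi legendreDr.
have chi_quat j : (1 <= j <= p - 1)%N -> chi j \in quaternary R.
  by move=> /ndvd_small /legendre_pm1[]; rewrite /chi => ->; rewrite !inE eqxx ?orbT.
split.
  move=> x /(nthP 0)[j]; rewrite size_tuple => lt_j <-.
  have [->|j_gt0] := posnP j; first by [].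
  have [ltjp|ltpj|->] := ltngtP j p.
  - by rewrite (Achi j _).1 ?chi_quat //; lia.
  - rewrite -(subnK (ltnW ltpj)) (Achi (j - p)%N _).2 ?chi_quat //; lia.
  - by rewrite Ap0; move/quaternaryP: A0 => [] ->; rewrite ?opprK !inE eqxx ?orbT.
apply/val_inj/(@eq_from_nth _ 0) => [|j]; rewrite !size_tuple // => ltjp.
rewrite nth_compression2 // -[RHS]periodic_small // periodic_Ap //.
have [->|j_gt0] := posnP j; first by rewrite add0n Ap0 subrr legendre_dvd ?mulr0.
have [|-> ->] := Achi j; first by lia.
by rewrite -/(chi j); ring.
Qed.

(** A decompression is determined by its entry of index 0, which can be any of
    the four quaternary numbers. *)
Lemma card_decompression_Ap :
  [set A : (2 * p).-tuple R[i] | decompression2 (Ap R p) A] #= `I_4.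
Proof.
pose dec (c : R[i]) : (2 * p).-tuple R[i] :=
  [tuple if val j == 0%N then c else if val j == p then - c else chi j | j < 2 * p].
have nth_dec c j : (j < 2 * p)%N ->
    (dec c)`_j = if j == 0%N then c else if j == p then - c else chi j.
  by move=> ltj; rewrite -[j in LHS]/(val (Ordinal ltj)) -tnth_nth tnth_mktuple.
have -> : [set A : (2 * p).-tuple R[i] | decompression2 (Ap R p) A] =
    [set dec (quaternary R)`_k | k in `I_4].
  apply/seteqP; split => A /=.
    move/decompression_ApP => [Ap0 A0 Achi].
    exists (index A`_0 (quaternary R)); first by move: A0; rewrite -index_mem.
    rewrite nth_index //; apply/val_inj/(@eq_from_nth _ 0) => [|j].
      by rewrite !size_tuple.
    rewrite size_tuple => lt_j; rewrite nth_dec //.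
    case: posnP => [-> //|j_gt0]; case: ltngtP => [ltjp|ltpj|-> //].
      by rewrite (Achi j _).1 //; lia.
    rewrite -{2}(subnK (ltnW ltpj)) (Achi (j - p)%N _).2; last by lia.
    by rewrite /chi -[in LHS](subnK (ltnW ltpj)) legendreDr.
  move=> [k k_lt4 <-]; apply/decompression_ApP.
  have p_neq0 : (p == 0%N) = false by apply/eqP; lia.
  rewrite !nth_dec ?muln_gt0 //; last by lia.
  rewrite p_neq0 !eqxx; split=> // [|j j_bounds]; first exact: mem_nth.
  rewrite !nth_dec; try lia.
  rewrite !ifN; try (apply/eqP; lia); split=> //.
  by rewrite /chi legendreDr.
apply: inj_card_eq => i j; rewrite !inE => lt_i lt_j eq_dec.
have := congr1 (fun A : (2 * p).-tuple R[i] => A`_0) eq_dec.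
rewrite !nth_dec ?muln_gt0 //= => /eqP.
by rewrite (nth_uniq _ _ _ (uniq_quaternary R)) // => /eqP.
Qed.

Section OfBp.
Variable B : (2 * p).-tuple R[i].
Hypothesis B_dec : decompression2 (Bp R p) B.

Lemma decompression_Bp_sum j :
  periodic B j + periodic B (j + p) = if (p %| j)%N then 1 + 'i else 0.
Proof. by rewrite -periodic_compression2 // B_dec.2 periodic_Bp. Qed.

Lemma decompression_Bp_ndvd j : ~~ (p %| j)%N -> periodic B (j + p) = - periodic B j.
Proof.
by move=> ndv; apply/eqP; rewrite -addr_eq0 addrC decompression_Bp_sum ifN.
Qed.

(** For j prime to p the terms j and j + p are both -1. The terms 0 and p
    cancel: b_0 and b_p are 1 and 'i in some order, and the product of one with the
    conjugate of the other is - 'i or 'i. *)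
Lemma PAFp_decompression_Bp : PAF B p = - (2 * p%:R) + 2.
Proof.
have quat i := quaternary_periodic p_gt0 i B_dec.1.
rewrite PAF_half // (bigD1 (Ordinal p_gt0)) //=.
rewrite (eq_bigr (fun=> -2)) => [|j /ord_ndvd ndv]; last first.
  rewrite -addnA addnn -mul2n periodicDl decompression_Bp_ndvd //.
  rewrite rmorphN /= mulrN mulNr -normCK norm_quaternary // expr1n; ring.
rewrite sumr_const cardC1 card_ord -[_ *+ p.-1]mulr_natr -subn1 natrB //.
rewrite -!addnA addnn -mul2n periodicDl.
have := decompression_Bp_sum 0; rewrite dvdn0 => sum0.
have [[-> ->]|[-> ->]] := quaternary_add_1Di (quat _) (quat _) sum0;
  by rewrite conjCi rmorph1; ring.
Qed.

(** (xi (2p)) ^+ p = -1, so DFT B p is a signed sum of quaternary numbers. *)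
Lemma DFT_half_gaussian : exists a b : int, DFT B p = a%:~R + 'i * b%:~R.
Proof.
have quat_gauss x : x \in quaternary R -> exists a b : int, x = a%:~R + 'i * b%:~R.
  case/quaternaryP => ->; [exists (-1), 0|exists 1, 0|exists 0, (-1)|exists 0, 1]; ring.
rewrite DFT_periodic.
pose gauss (x : R[i]) := exists a b : int, x = a%:~R + 'i * b%:~R.
apply: (big_ind gauss) => [|x y [a [b ->]] [c [d ->]]|j _].
- by exists 0, 0; ring.
- by exists (a + c), (b + d); rewrite !rmorphD /=; ring.
have [a [b ->]] := quat_gauss _ (quaternary_periodic p_gt0 j B_dec.1).
rewrite [(j * p)%N]mulnC exprM xi_half // -signr_odd; case: (odd j); last by exists a, b; ring.
by exists (- a), (- b); rewrite !rmorphN /=; ring.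
Qed.

End OfBp.

(** * Legendre pairs *)

Section LegendrePair.
Variables A B : (2 * p).-tuple R[i].
Hypotheses (A_dec : decompression2 (Ap R p) A) (B_dec : decompression2 (Bp R p) B).
Hypothesis AB_pair : legendre_pair A B.

Lemma PAF_pair_Bp s : (1 <= s <= p - 1)%N -> PAF B s = 0 /\ PAF B (2 * p - s) = 0.
Proof.
move=> s_bounds; have B0 : PAF B s = 0.
  have := AB_pair (s := s); rewrite mulKn // PAF_decompression_Ap ?ndvd_small // => sum.
  by apply: (addrI (-2)); rewrite addr0 sum //; lia.
by rewrite PAF_sub ?muln_gt0 // ?B0 ?rmorph0 //; lia.
Qed.

(** PAF B vanishes outside 0 and p, so that the Wiener-Khinchin sum is
    PAF B 0 - PAF B p = 2p - (2 - 2p) at an odd frequency. *)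
Lemma PSD_odd_pair_Bp t : odd t -> PSD B t = 4 * p%:R - 2.
Proof.
move=> t_odd; rewrite PSD_sum_PAF ?muln_gt0 //.
rewrite (sum_double _ (fun i => PAF B i * xi R (2 * p) ^- (i * t))).
rewrite (bigD1 (Ordinal p_gt0)) //= big1 => [|j j_neq0].
  rewrite add0n mul0n expr0 invr1 exprM xi_half // -signr_odd t_odd.
  rewrite PAFp_decompression_Bp // (PAF0_quaternary p_gt0 B_dec.1) expr1 invrN1.
  by ring.
have j_bounds : (1 <= j <= p - 1)%N.
  have := ltn_ord j; move: j_neq0; rewrite -val_eqE /=; lia.
rewrite (PAF_pair_Bp j_bounds).1.
have rev_bounds : (1 <= p - j <= p - 1)%N by lia.
have -> : (j + p = 2 * p - (p - j))%N by lia.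
by rewrite (PAF_pair_Bp rev_bounds).2 !mul0r addr0.
Qed.

(** a ^+ 2 + b ^+ 2 is PSD B p, and it is 2 modulo 4, so both squares are odd. *)
Lemma DFT_half_pair_Bp : exists a b : int,
  [/\ DFT B p = a%:~R + 'i * b%:~R, a ^+ 2 + b ^+ 2 = 4 * p%:Z - 2,
      (a = 1 %[mod 2])%Z & (b = 1 %[mod 2])%Z].
Proof.
have [a [b DFTab]] := DFT_half_gaussian B_dec; exists a, b.
have norm_ab : a ^+ 2 + b ^+ 2 = 4 * p%:Z - 2.
  apply/eqP; rewrite -(eqr_int R[i]); apply/eqP.
  have := PSD_odd_pair_Bp p_odd; rewrite /PSD DFTab normCK rmorphD rmorphM /= conjCi.
  rewrite !rmorph_int (_ : _ * _ = a%:~R ^+ 2 - 'i ^+ 2 * b%:~R ^+ 2); last by ring.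
  rewrite sqrCi mulN1r opprK rmorphD !rmorphXn /= => ->.
  by rewrite rmorphB rmorphM /=.
have odd_of (x y : int) : x ^+ 2 + y ^+ 2 = 4 * p%:Z - 2 -> (x = 1 %[mod 2])%Z.
  move=> xy.
  have halve (w : int) : exists q : int, w = 2 * q \/ w = 2 * q + 1.
    by exists (w %/ 2)%Z; lia.
  have [q [xE|->]] := halve x; last by lia.
  by exfalso; move: xy; have [r [->|->]] := halve y; rewrite xE !expr2; lia.
split=> //; first exact: odd_of norm_ab.
by apply: (odd_of b a); rewrite addrC.
Qed.

End LegendrePair.
End Decompression.

Theorem theorem2 (R : realType) (p : nat) (p_prime : prime p) (p_gt2 : (2 < p)%N) :
  let rtp : R[i] := (Num.sqrt (p%:R : R))%:C in
  let chi (j : nat) : R[i] := (legendre p j)%:~R in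
  [/\ (* 1 *)
      [/\ PAF (Ap R p) 0 = 4 * (p%:R - 1),
          PAF (Bp R p) 0 = 2 &
          forall s : nat, (1 <= s <= p - 1)%N ->
            PAF (Ap R p) s = -4 /\ PAF (Bp R p) s = 0],
      (* 2 *)
      forall s : nat, (1 <= s <= p - 1)%N ->
        ((p = 1 %[mod 4])%N -> DFT (Ap R p) s = 2 * chi s * rtp) /\
        ((p = 3 %[mod 4])%N -> DFT (Ap R p) s = 2 * 'i * chi s * rtp) /\
        DFT (Bp R p) s = 1 + 'i /\
        PSD (Ap R p) s = 4 * p%:R /\
        PSD (Bp R p) s = 2 /\
        PSD (Ap R p) s + PSD (Bp R p) s = 2 * (2 * p%:R + 1),
      (* 3 *)
      [/\ [set A : (2 * p).-tuple R[i] | decompression2 (Ap R p) A] #= `I_4,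
          forall A : (2 * p).-tuple R[i],
            decompression2 (Ap R p) A <->
            [/\ A`_p = - A`_0,
                A`_0 \in [:: -1; 1; - 'i; 'i] &
                forall j : nat, (1 <= j <= p - 1)%N ->
                  A`_j = chi j /\ A`_(j + p) = chi j] &
          forall A : (2 * p).-tuple R[i], decompression2 (Ap R p) A ->
            [/\ PAF A 0 = 2 * p%:R,
                PAF A p = 2 * p%:R - 4,
                forall s : nat, (1 <= s <= p - 1)%N ->
                  PAF A s = -2 /\ PAF A (2 * p - s) = -2,
                forall s : nat, (1 <= s <= p - 1)%N ->
                  ((p = 1 %[mod 4])%N -> DFT A (2 * s) = 2 * chi s * rtp) /\
                  ((p = 3 %[mod 4])%N ->
                     DFT A (2 * s) = 2 * chi s * ('i * rtp)) /\
                  PSD A (2 * s) = 4 * p%:R &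
                forall s : nat, (1 <= s <= p)%N ->
                  DFT A (2 * s - 1) = 2 * A`_0 /\ PSD A (2 * s - 1) = 4]],
      (* 4 *)
      forall B : (2 * p).-tuple R[i], decompression2 (Bp R p) B ->
        [/\ B`_0 + B`_p = 1 + 'i,
            forall j : nat, (1 <= j <= p - 1)%N -> B`_(j + p) = - B`_j,
            PAF B 0 = 2 * p%:R,
            PAF B p = - (2 * p%:R) + 2 &
            forall s : nat, (1 <= s <= p - 1)%N ->
              DFT B (2 * s) = 1 + 'i /\ PSD B (2 * s) = 2] &
      (* 5 *)
      forall A B : (2 * p).-tuple R[i],
        decompression2 (Ap R p) A -> decompression2 (Bp R p) B ->
        legendre_pair A B ->
        [/\ forall s : nat, (1 <= s <= p - 1)%N ->
              PAF B s = 0 /\ PAF B (2 * p - s) = 0,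
            forall s : nat, (1 <= s <= p)%N ->
              PSD B (2 * s - 1) = 4 * p%:R - 2 &
            exists a b : int,
              [/\ DFT B p = a%:~R + 'i * b%:~R,
                  a ^+ 2 + b ^+ 2 = 4 * p%:Z - 2,
                  (a = 1 %[mod 2])%Z & (b = 1 %[mod 2])%Z]]].
Proof.
move=> rtp chi.
have p_odd : odd p by case: (even_prime p_prime) p_gt2 => // ->.
have p_gt0 : (0 < p)%N by apply: prime_gt0.
have ndvd s : (1 <= s <= p - 1)%N -> ~~ (p %| s)%N.
  by move=> /andP[s1 s2]; rewrite gtnNdvd //; lia.
have half1 : (p = 1 %[mod 4])%N -> odd p./2 = false by lia.
have half3 : (p = 3 %[mod 4])%N -> odd p./2 by lia.
have odd_pred s : (1 <= s <= p)%N -> odd (2 * s - 1) by lia.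
split.
- split=> [||s s_bounds]; first exact: PAF_Ap0.
    by rewrite PAF_Bp // dvdn0.
  by rewrite PAF_Ap ?PAF_Bp ?ifN ?ndvd.
- move=> s /ndvd ndv; rewrite DFT_Ap // DFT_Bp // PSD_Ap // PSD_Bp // -/rtp -/(chi s).
  split; first by move/half1->; rewrite expr0 mul1r.
  by split; [move/half3->; rewrite expr1; ring | do !split; ring].
- split=> [|A|A A_dec]; first exact: card_decompression_Ap.
    exact: decompression_ApP.
  split=> [|||s /ndvd ndv|s s_bounds].
  + exact: PAF0_quaternary A_dec.1.
  + exact: PAFp_decompression_Ap.
  + move=> s s_bounds; have PAFs := PAF_decompression_Ap p_prime p_odd A_dec (ndvd s s_bounds).
    by rewrite PAF_sub ?muln_gt0 ?PAFs //; [rewrite rmorphN /= conjC_nat | lia].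
  + rewrite PSD_even // DFT_even // A_dec.2 DFT_Ap // PSD_Ap // -/rtp -/(chi s).
    by split; [move/half1->; rewrite expr0 mul1r|split=> // /half3->].
  + have DFTs := DFT_odd_decompression_Ap p_prime A_dec (odd_pred s s_bounds).
    split=> //; rewrite /PSD DFTs normrM [`|A`_0|]norm_quaternary; last first.
      by case/(decompression_ApP p_prime p_odd): A_dec.
    by rewrite mulr1 normr_nat; ring.
- move=> B B_dec.
  have small i : (i < 2 * p)%N -> periodic B i = B`_i := @periodic_small _ _ B i.
  split=> [|j j_bounds|||s /ndvd ndv].
  + have := decompression_Bp_sum p_prime B_dec 0; rewrite dvdn0 !small ?muln_gt0 //; lia.
  + have := decompression_Bp_ndvd p_prime B_dec (ndvd j j_bounds); rewrite !small //; lia.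
  + exact: PAF0_quaternary B_dec.1.
  + exact: PAFp_decompression_Bp.
  + by rewrite PSD_even // DFT_even // B_dec.2 DFT_Bp // PSD_Bp.
- move=> A B A_dec B_dec AB_pair; split=> [s|s /odd_pred|].
  + exact: (PAF_pair_Bp p_prime p_odd A_dec AB_pair).
  + exact: (PSD_odd_pair_Bp p_prime p_odd A_dec B_dec AB_pair).
  + exact: (DFT_half_pair_Bp p_prime p_odd A_dec B_dec AB_pair).
Qed.
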